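(* Let $g:\mathbb{R}\to\mathbb{R}$ be a real-valued periodic function with Fourier series $g(x)=\sum_{n\in\mathbb{Z}} g_n e^{inx}$, and suppose there are constants $D>0$ and $r\in(0,1)$ such that $|g_n|\le D r^{|n|}$ for all $n\in\mathbb{Z}$. Let $x_0\in\mathbb{R}$ and let $x(t)$ be the solution of $\dot x=g(x)$, $x(0)=x_0$. For $N\ge 1$ let ${\bf y}_{1,N}(t)=[y_{1,N}^+(t),\,y_{1,N}^-(t)]^{\mathsf T}$ be the first block of the solution of the finite-section approximation of order $N$ of the Carleman-Fourier linearization of this system (defined in the context). Set $$T_0=\frac{1}{2D}\Big(\frac{1}{\sqrt r}-1\Big)^2 .$$ Then for every $N\ge 1$ and all $0\le t\le T_0$, $$\big|y_{1,N}^{\pm}(t)-e^{\pm i x(t)}\big|\le \frac{\sqrt{2Dt}}{N(1-r)}\,\big(1+\sqrt{2Dt}\big)^{2N} r^N .$$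
   Context: For integers $1\le k\le l$ define the $(k+1)\times(l+1)$ matrix ${\bf B}_{k,l}=[b_{k,l;p,q}]_{0\le p\le k,\,0\le q\le l}$ by $b_{k,l;p,q}=i(k-2p)\,g_{l-k}$ if $q=p$; $b_{k,l;p,q}=i(k-2p)\,g_{k-l}$ if $q=l-k+p$; and $b_{k,l;p,q}=0$ otherwise (when $l=k$ the first two cases coincide and give the diagonal entry $i(k-2p)g_0$). For $k\ge 1$ let ${\bf y}_k^0=[e^{ikx_0},e^{i(k-2)x_0},\ldots,e^{-i(k-2)x_0},e^{-ikx_0}]^{\mathsf T}\in\mathbb{C}^{k+1}$, i.e. the $p$-th entry is $e^{i(k-2p)x_0}$, $0\le p\le k$. The finite-section approximation of order $N\ge1$ of the Carleman-Fourier linearization is the finite-dimensional block upper triangular linear system for unknowns ${\bf y}_{k,N}(t)\in\mathbb{C}^{k+1}$, $1\le k\le N$: $$\dot{\bf y}_{k,N}(t)=\sum_{l=k}^{N}{\bf B}_{k,l}\,{\bf y}_{l,N}(t),\qquad {\bf y}_{k,N}(0)={\bf y}_k^0,\qquad 1\le k\le N .$$ Its first block is ${\bf y}_{1,N}(t)=[y_{1,N}^+(t),y_{1,N}^-(t)]^{\mathsf T}\in\mathbb{C}^2$. The displayed inequality is asserted for both choices of sign. *)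

(* Defs.v *)
From Stdlib Require Import Reals ZArith.
From Coquelicot Require Import Coquelicot.
Open Scope R_scope.

Definition Cexp (z : C) : C :=
  (RtoC (exp (Re z)) * (cos (Im z), sin (Im z)))%C.

(** The value [e^{i m x}]. *)
Definition expi (m : Z) (x : R) : C :=
  Cexp (Ci * RtoC (IZR m) * RtoC x)%C.

(** The two-sided series is taken as the limit of its symmetric partial sums
    [sum_{n = -M}^{M} gn n e^{inx}]; the index [j = n + M] runs over [0..2M]. *)
Definition fourier_partial (gn : Z -> C) (x : R) (M : nat) : C :=
  sum_n (fun j : nat =>
           let n := (Z.of_nat j - Z.of_nat M)%Z in (gn n * expi n x)%C)
        (2 * M).

Definition has_fourier_series (g : R -> R) (gn : Z -> C) : Prop :=
  (forall x : R, g (x + 2 * PI) = g x) /\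
  (forall x : R,
      filterlim (fourier_partial gn x) eventually (locally (RtoC (g x)))).

(** Derivative along [[0, +oo)]: two-sided for [0 < t], right derivative
    at [t = 0]. *)
Definition is_derive_fwd {V : NormedModule R_AbsRing}
    (f : R -> V) (t : R) (l : V) : Prop :=
  @filterdiff R_AbsRing R_NormedModule V f
    (within (fun s : R => 0 <= s) (locally t)) (fun h : R => scal h l).

Definition solves_ode (g : R -> R) (x0 : R) (x : R -> R) : Prop :=
  x 0 = x0 /\
  forall t : R, 0 <= t ->
    is_derive_fwd (V := R_NormedModule) x t (g (x t)).

(** The entry [(p, q)] of [B_{k,l}], meaningful for [1 <= k <= l], [p <= k] and
    [q <= l]. *)
Definition Bcoef (gn : Z -> C) (k l p q : nat) : C :=
  let c := (Ci * RtoC (IZR (Z.of_nat k - 2 * Z.of_nat p)))%C in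
  if Nat.eqb q p then (c * gn (Z.of_nat l - Z.of_nat k)%Z)%C
  else if Nat.eqb q (l - k + p) then (c * gn (Z.of_nat k - Z.of_nat l)%Z)%C
  else RtoC 0.

Definition y_init (x0 : R) (k p : nat) : C :=
  expi (Z.of_nat k - 2 * Z.of_nat p) x0.

(** [y k p t] is the [p]-th entry ([0 <= p <= k]) of the block [y_{k,N}(t)],
    [1 <= k <= N]; values of [y] at other indices are irrelevant. *)
Definition solves_finite_section
    (gn : Z -> C) (x0 : R) (N : nat) (y : nat -> nat -> R -> C) : Prop :=
  forall k p : nat, (1 <= k <= N)%nat -> (p <= k)%nat ->
    y k p 0 = y_init x0 k p /\
    forall t : R, 0 <= t ->
      is_derive_fwd (V := C_R_NormedModule) (y k p) t
        (sum_n_m (fun l : nat =>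
            sum_n (fun q : nat => (Bcoef gn k l p q * y l q t)%C) l) k N).

Definition T0 (D r : R) : R := 1 / (2 * D) * (1 / sqrt r - 1) ^ 2.

Definition error_bound (D r : R) (N : nat) (t : R) : R :=
  sqrt (2 * D * t) / (INR N * (1 - r))
  * (1 + sqrt (2 * D * t)) ^ (2 * N) * r ^ N.

(* Main.v *)
Require Import Defs.
From Stdlib Require Import Reals ZArith Lra Lia.
From Coquelicot Require Import Coquelicot.
Open Scope R_scope.

(** The exact modes [e^{imx(t)}] satisfy the untruncated linearized system, so
    the error [e_{k,p} = y_{k,p} - e^{i(k-2p)x}] of the section of order [N]
    solves, with [m = k - 2p],
      [e_{k,p}' = i m g_0 e_{k,p}
         + i m (sum_{d=1}^{N-k} (g_d e_{k+d,p} + g_{-d} e_{k+d,p+d})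
                - tau e^{imx})],
    where [tau] is the tail of the Fourier series of [g] beyond order [N-k], of
    size at most [2 D r^{N-k+1} / (1-r)] ([section_row_eq], [fourier_tail]).

    Since [g] is real, so is its mean [g_0] ([mean_mode_real]); the diagonal
    term is then a pure rotation, and [|e_{k,p}|] grows no faster than the
    integral of the remaining forcing ([rotating_frame_bound]). Put
    [s = 2 D t] and [c = r^{N+1} / (1-r)]. Downward induction on [k]
    ([block_error_bound]) gives [|e_{k,p}(t)| <= c r^{-k} w_k(s)] as soon as
      [w_k' = k (1 + sum_{l=k+1}^N w_l)],  [w_k(0) = 0].
    The partial sums [W_k = 1 + sum_{l>=k} w_l] obey [W_{N+1} = 1] and
    [W_k = W_{k+1} + k J W_{k+1}], [J] being integration from [0]; that is,
    [W_k = (1 + k J) ... (1 + N J) 1], the polynomial [majorant] below.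

    It remains to bound [w_1 = J W_2]. The factors [1 + jJ] commute, so the
    coefficients of [W_2] can be estimated by induction on [N]
    ([majorant_coef_2_le_binom]): that of [s^m] is at most
    [(m+1)/N * binom (2N) (2m+1)]. After integration these are the odd terms of
    the expansion of [(1 + sqrt s)^{2N}], which yields
    [w_1(s) <= sqrt s / N * (1 + sqrt s)^{2N}] ([majorant_first_bound]).  With
    [k = 1] this is the asserted inequality. *)

(** * Binomial coefficients *)

(** Pascal's recursion makes [binom n k] vanish for [k > n], so that the
    absorption identities hold for all indices; a quotient of factorials with
    truncated subtraction would not have this property. *)
Fixpoint binom (n k : nat) : R :=
  match n, k with
  | _, O => 1
  | O, S _ => 0
  | S n', S k' => binom n' k' + binom n' k
  end.

Lemma binom_n_0 n : binom n 0 = 1.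
Proof. now destruct n. Qed.

Lemma binom_nonneg n k : 0 <= binom n k.
Proof.
  revert k; induction n as [|n IH]; intros [|k]; simpl; try lra.
  specialize (IH k) as H1; specialize (IH (S k)); lra.
Qed.

Lemma binom_high n k : (n < k)%nat -> binom n k = 0.
Proof.
  revert k; induction n as [|n IH]; intros [|k] Hk; simpl; try lia; try lra.
  rewrite !IH by lia; lra.
Qed.

Lemma binom_absorb_upper n k :
  INR (S k) * binom n (S k) = (INR n - INR k) * binom n k.
Proof.
  revert k; induction n as [|n IH]; intros k.
  - destruct k; simpl; lra.
  - destruct k as [|k].
    + generalize (IH O); rewrite !S_INR; simpl binom; rewrite binom_n_0.
      simpl INR; lra.
    + generalize (IH (S k)); generalize (IH k); rewrite !S_INR.
      simpl binom; lra.
Qed.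

Lemma binom_absorb n k :
  INR (S k) * binom (S n) (S k) = INR (S n) * binom n k.
Proof.
  simpl binom. generalize (binom_absorb_upper n k); rewrite !S_INR; lra.
Qed.

Lemma binomial_expansion n z :
  (1 + z) ^ n = sum_f_R0 (fun k => binom n k * z ^ k) n.
Proof.
  induction n as [|n IH]; [simpl; lra|].
  assert (Hz : forall j, (j <= n)%nat ->
    sum_f_R0 (fun k => binom (S n) k * z ^ k) (S j)
    = z * sum_f_R0 (fun k => binom n k * z ^ k) j
      + sum_f_R0 (fun k => binom n k * z ^ k) (S j)).
  { induction j as [|j IHj]; intros Hj.
    - simpl. rewrite !binom_n_0. lra.
    - rewrite tech5, IHj by lia. simpl. lra. }
  rewrite Hz by lia. rewrite (tech5 (fun k => binom n k * z ^ k) n).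
  rewrite binom_high by lia. rewrite <- IH. simpl. lra.
Qed.

Lemma odd_terms_le_sum (a : nat -> R) n :
  (forall k, 0 <= a k) ->
  sum_f_R0 (fun m => a (2 * m + 1)%nat) n <= sum_f_R0 a (2 * n + 2).
Proof.
  intros Ha; induction n as [|n IH].
  - simpl. generalize (Ha O) (Ha 2%nat); lra.
  - rewrite tech5.
    replace (2 * S n + 2)%nat with (S (S (2 * n + 2))) by lia.
    rewrite !tech5.
    replace (2 * S n + 1)%nat with (S (2 * n + 2)) by lia.
    generalize (Ha (S (S (2 * n + 2)))); lra.
Qed.

(** * The comparison polynomials *)

(** The operator [1 + jJ] on coefficient sequences, [J] being integration from
    [0]. *)
Definition integral_factor (j : nat) (c : nat -> R) (m : nat) : R :=
  match m with
  | O => c O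
  | S m' => c (S m') + INR j / INR (S m') * c m'
  end.

(** Coefficients of [(1 + lo J) (1 + (lo+1) J) ... (1 + (lo+n-1) J) 1]; that of
    [s^m] is [1/m!] times the [m]-th elementary symmetric function of
    [lo, ..., lo+n-1]. *)
Fixpoint majorant_coef (lo n : nat) : nat -> R :=
  match n with
  | O => fun m => match m with O => 1 | S _ => 0 end
  | S n' => integral_factor lo (majorant_coef (S lo) n')
  end.

Definition majorant (lo n : nat) (s : R) : R :=
  sum_f_R0 (fun m => majorant_coef lo n m * s ^ m) n.

Lemma majorant_coef_high lo n m : (n < m)%nat -> majorant_coef lo n m = 0.
Proof.
  revert lo m; induction n as [|n IH]; intros lo [|m] Hm; try lia; [easy|].
  simpl majorant_coef; unfold integral_factor. rewrite !IH by lia. lra.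
Qed.

Lemma integral_factor_comm i j c m :
  integral_factor i (integral_factor j c) m = integral_factor j (integral_factor i c) m.
Proof.
  destruct m as [|[|m]]; simpl integral_factor; trivial.
  - lra.
  - unfold Rdiv; ring.
Qed.

Lemma integral_factor_ext j c c' :
  (forall m, c m = c' m) ->
  forall m, integral_factor j c m = integral_factor j c' m.
Proof. intros H [|m]; unfold integral_factor; now rewrite ?H. Qed.

(** The recursion peels off the lowest factor, as the induction over the blocks
    requires; since the factors commute, the highest one can be peeled off
    instead, which is what an induction on the order of the section needs. *)
Lemma majorant_coef_top lo n m :
  majorant_coef lo (S n) m = integral_factor (lo + n) (majorant_coef lo n) m.
Proof.
  revert lo m; induction n as [|n IH]; intros lo m.
  - now rewrite Nat.add_0_r.
  - change (majorant_coef lo (S (S n)))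
      with (integral_factor lo (majorant_coef (S lo) (S n))).
    rewrite (integral_factor_ext _ _ _ (IH (S lo))), integral_factor_comm.
    now replace (S lo + n)%nat with (lo + S n)%nat by lia.
Qed.

Lemma majorant_increment lo n s :
  majorant lo (S n) s - majorant (S lo) n s =
  sum_f_R0 (fun m => INR lo / INR (S m) * majorant_coef (S lo) n m * s ^ S m) n.
Proof.
  assert (H : forall j,
    sum_f_R0 (fun m => integral_factor lo (majorant_coef (S lo) n) m * s ^ m) (S j) =
    sum_f_R0 (fun m => majorant_coef (S lo) n m * s ^ m) (S j) +
    sum_f_R0 (fun m => INR lo / INR (S m) * majorant_coef (S lo) n m * s ^ S m) j).
  { induction j as [|j IH]; [simpl; lra|].
    rewrite tech5, IH.
    rewrite (tech5 (fun m => majorant_coef (S lo) n m * s ^ m) (S j)).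
    rewrite (tech5 (fun m => INR lo / INR (S m) * majorant_coef (S lo) n m * s ^ S m) j).
    unfold integral_factor. ring. }
  unfold majorant.
  change (majorant_coef lo (S n)) with (integral_factor lo (majorant_coef (S lo) n)).
  rewrite H, tech5, majorant_coef_high by lia. ring.
Qed.

Lemma majorant_increment_0 lo n : majorant lo (S n) 0 - majorant (S lo) n 0 = 0.
Proof.
  rewrite majorant_increment.
  assert (H : forall j,
    sum_f_R0 (fun m => INR lo / INR (S m) * majorant_coef (S lo) n m * 0 ^ S m) j = 0).
  { induction j as [|j IH]; [simpl; ring|].
    rewrite tech5, IH, pow_ne_zero by lia. ring. }
  apply H.
Qed.

(** As [W_k - W_{k+1} = k J W_{k+1}], the increments solve the scalar comparison
    system. *)
Lemma is_derive_majorant_increment lo n (s : R) :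
  is_derive (fun s => majorant lo (S n) s - majorant (S lo) n s) s
    (INR lo * majorant (S lo) n s).
Proof.
  eapply is_derive_ext; [intros u; symmetry; apply majorant_increment|].
  unfold majorant. generalize n at 2 4 as j.
  induction j as [|j IH].
  - simpl. auto_derive; trivial.
    match goal with |- ?a = ?b => change (@eq R a b) end. field.
  - eapply is_derive_ext; [intros u; symmetry; apply tech5|].
    rewrite tech5, Rmult_plus_distr_l.
    apply (is_derive_plus (K := R_AbsRing) (V := R_NormedModule)); [exact IH|].
    auto_derive; trivial.
    simpl pred. assert (INR (S (S j)) <> 0) by (apply not_0_INR; lia).
    change (match j with O => 1 | S _ => INR j + 1 end) with (INR (S j)).
    rewrite <- (S_INR (S j)).
    match goal with |- ?a = ?b => change (@eq R a b) end. simpl pow. field; trivial.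
Qed.

(** The right-hand side is [(m+1)/N * binom (2N) (2m+1)] with [N = n+1], written
    so that raising [N] by one is two Pascal steps in [binom (2n+1) (2m)].  Passing
    to the next order then comes down to the positivity of
    [(4m+10) (n-m) binom (2n+1) (2m)]: for [m <= n] all factors are nonnegative,
    and for [m > n] the binomial vanishes. *)
Lemma majorant_coef_2_le_binom n m :
  majorant_coef 2 n m <=
  (2 * INR m + 2) / (2 * INR m + 1) * binom (2 * n + 1) (2 * m).
Proof.
  revert m; induction n as [|n IH]; intros m.
  - assert (Hm := pos_INR m). destruct m as [|m].
    + simpl; lra.
    + apply Rmult_le_pos; [apply Rdiv_le_0_compat; lra|apply binom_nonneg].
  - rewrite majorant_coef_top. destruct m as [|m].
    + simpl integral_factor. eapply Rle_trans; [apply IH|].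
      rewrite !Nat.mul_0_r, !binom_n_0; lra.
    + unfold integral_factor.
      replace (2 * S n + 1)%nat with (S (S (2 * n + 1))) by lia.
      replace (2 * S m)%nat with (S (S (2 * m))) by lia.
      assert (H1 := IH (S m)). assert (H0 := IH m).
      replace (2 * S m)%nat with (S (S (2 * m))) in H1 by lia.
      assert (Hb := binom_absorb_upper (2 * n + 1) (2 * m)).
      assert (HB := binom_nonneg (2 * n + 1) (2 * m)).
      assert (Hpascal : forall a b, binom (S (S a)) (S (S b))
        = binom a b + binom a (S b) + (binom a (S b) + binom a (S (S b))))
        by reflexivity.
      rewrite Hpascal.
      set (b0 := binom (2 * n + 1) (2 * m)) in *.
      set (b1 := binom (2 * n + 1) (S (2 * m))) in *.
      set (b2 := binom (2 * n + 1) (S (S (2 * m)))) in *.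
      assert (Hm := pos_INR m). assert (Hn := pos_INR n).
      (* Beyond the diagonal the binomial is zero, so the sign of [n - m] is
         harmless there. *)
      assert (Hcase : b0 = 0 \/ INR m <= INR n).
      { destruct (Nat.le_gt_cases m n); [right; now apply le_INR|left].
        apply binom_high; lia. }
      rewrite ?S_INR, ?plus_INR, ?mult_INR, ?S_INR in *. simpl INR in *.
      set (M := INR m) in *; set (K := INR n) in *.
      assert (Hstep : (1 + 1 + K) / (M + 1) * ((2 * M + 2) / (2 * M + 1) * b0)
        <= (2 * (M + 1) + 2) / (2 * (M + 1) + 1) * (b0 + 2 * b1)).
      { assert (Eb : b1 = (2 * K + 1 - 2 * M) / (2 * M + 1) * b0).
        { apply (Rmult_eq_reg_l (2 * M + 1)); [|lra].
          replace ((2 * M + 1) * ((2 * K + 1 - 2 * M) / (2 * M + 1) * b0))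
            with ((2 * K + 1 - 2 * M) * b0) by (field; lra).
          lra. }
        rewrite Eb.
        apply Rminus_le_0.
        replace (_ - _) with
          ((4 * M + 10) * (K - M) * b0 / ((2 * M + 3) * (2 * M + 1)))
          by (field; lra).
        destruct Hcase as [->|Hc]; [lra|].
        apply Rdiv_le_0_compat; [|nra].
        apply Rmult_le_pos; [nra|trivial]. }
      assert (Hc0 : (1 + 1 + K) / (M + 1) * majorant_coef 2 n m
        <= (1 + 1 + K) / (M + 1) * ((2 * M + 2) / (2 * M + 1) * b0)).
      { apply Rmult_le_compat_l; [apply Rdiv_le_0_compat; lra|trivial]. }
      replace (0 + 1 + 1 + K) with (1 + 1 + K) by ring.
      set (F := (2 * (M + 1) + 2) / (2 * (M + 1) + 1)) in *.
      replace (F * _) with (F * (b0 + 2 * b1) + F * b2) by ring.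
      lra.
Qed.

(** With [z = sqrt s], the coefficient bound turns the term of degree [m+1] into
    [z/N] times the term of degree [2m+1] of [(1+z)^{2N}]. *)
Lemma majorant_first_bound n s : 0 <= s ->
  majorant 1 (S n) s - majorant 2 n s <=
  sqrt s / INR (S n) * (1 + sqrt s) ^ (2 * S n).
Proof.
  intros Hs. rewrite majorant_increment, binomial_expansion.
  assert (HN : 0 < INR (S n)) by (apply lt_0_INR; lia).
  assert (Hz := sqrt_pos s). set (z := sqrt s) in *.
  assert (Hzs : s = z ^ 2) by (unfold z; simpl; rewrite Rmult_1_r; now rewrite sqrt_sqrt).
  set (a := fun k => binom (2 * S n) k * z ^ k).
  replace (2 * S n)%nat with (2 * n + 2)%nat by lia.
  eapply Rle_trans;
    [|apply Rmult_le_compat_l;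
      [apply Rdiv_le_0_compat; trivial|apply (odd_terms_le_sum a)];
      intros k; apply Rmult_le_pos; [apply binom_nonneg|now apply pow_le]].
  rewrite scal_sum. apply sum_Rle. intros m _. unfold a.
  replace (2 * S n)%nat with (S (2 * n + 1)) by lia.
  replace (2 * m + 1)%nat with (S (2 * m)) by lia.
  assert (Habs := binom_absorb (2 * n + 1) (2 * m)).
  assert (Hc := majorant_coef_2_le_binom n m).
  assert (Hm := pos_INR m).
  assert (HNn : INR (S (2 * n + 1)) = 2 * INR (S n)).
  { rewrite !S_INR, plus_INR, mult_INR. simpl; lra. }
  rewrite HNn in Habs.
  assert (Hk : INR (S (2 * m)) = 2 * INR m + 1).
  { rewrite !S_INR, mult_INR. simpl; lra. }
  rewrite Hk in Habs.
  replace (s ^ S m) with (z * z ^ S (2 * m))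
    by (rewrite Hzs, <- pow_mult;
        replace (2 * S m)%nat with (S (S (2 * m))) by lia; reflexivity).
  set (B := binom (S (2 * n + 1)) (S (2 * m))) in *.
  set (b := binom (2 * n + 1) (2 * m)) in *.
  assert (EB : b = (2 * INR m + 1) / (2 * INR (S n)) * B).
  { apply (Rmult_eq_reg_l (2 * INR (S n))); [|lra]. rewrite <- Habs. field; lra. }
  rewrite EB in Hc.
  replace (B * z ^ S (2 * m) * (z / INR (S n)))
    with (/ INR (S n) * B * (z * z ^ S (2 * m))) by (field; lra).
  apply Rmult_le_compat_r; [apply Rmult_le_pos; [trivial|now apply pow_le]|].
  rewrite (S_INR m). simpl (INR 1).
  replace (/ INR (S n) * B) with
    (1 / (INR m + 1) * ((2 * INR m + 2) / (2 * INR m + 1)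
       * ((2 * INR m + 1) / (2 * INR (S n)) * B))) by (field; lra).
  apply Rmult_le_compat_l; [apply Rdiv_le_0_compat; lra|trivial].
Qed.

(** * Fourier modes and the mean of a real series *)

Lemma expi_eq m x : expi m x = (cos (IZR m * x), sin (IZR m * x)).
Proof.
  unfold expi, Cexp, Ci, RtoC, Cmult; simpl.
  replace (_ * x - _ * 0) with 0 by ring.
  rewrite exp_0. apply injective_projections; simpl;
  match goal with |- context [cos ?a] => replace a with (IZR m * x) by ring end; ring.
Qed.

Lemma expi_add a b x : expi (a + b) x = (expi a x * expi b x)%C.
Proof.
  rewrite !expi_eq, plus_IZR, Rmult_plus_distr_r.
  apply injective_projections; simpl; [apply cos_plus|rewrite sin_plus; ring].
Qed.

Lemma Cmod_expi m x : Cmod (expi m x) = 1.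
Proof.
  rewrite expi_eq. unfold Cmod; simpl.
  generalize (sin2_cos2 (IZR m * x)); unfold Rsqr; intros H.
  replace (_ + _) with 1 by lra. apply sqrt_1.
Qed.

(** The modes [d] and [-d] enter together: in the symmetric partial sums of the
    series, and in the coupling of block [k] to block [k+d]. *)
Definition mode_pair (gn : Z -> C) (u v : nat -> C) (d : nat) : C :=
  match d with
  | O => (gn 0%Z * u O)%C
  | S _ => (gn (Z.of_nat d) * u d + gn (- Z.of_nat d)%Z * v d)%C
  end.

Lemma fourier_partial_eq gn x M :
  fourier_partial gn x M =
  sum_n (mode_pair gn (fun d => expi (Z.of_nat d) x)
                      (fun d => expi (- Z.of_nat d) x)) M.
Proof.
  induction M as [|M IH].
  - unfold fourier_partial; simpl. now rewrite !sum_O.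
  - rewrite sum_Sn, <- IH. unfold fourier_partial.
    replace (2 * S M)%nat with (S (S (2 * M))) by lia.
    rewrite sum_Sn. unfold sum_n at 1. rewrite sum_Sn_m by lia.
    rewrite <- sum_n_m_S.
    rewrite (sum_n_m_ext _ (fun j =>
       let n := (Z.of_nat j - Z.of_nat M)%Z in (gn n * expi n x)%C) 0 (2 * M));
      [|intros j; cbv zeta; now replace (Z.of_nat (S j) - Z.of_nat (S M))%Z
         with (Z.of_nat j - Z.of_nat M)%Z by lia].
    replace (Z.of_nat 0 - Z.of_nat (S M))%Z with (- Z.of_nat (S M))%Z by lia.
    replace (Z.of_nat (S (S (2 * M))) - Z.of_nat (S M))%Z with (Z.of_nat (S M)) by lia.
    unfold mode_pair, sum_n. set (n := Z.of_nat (S M)). cbv zeta.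
    set (s := sum_n_m _ _ _).
    change ((gn (- n)%Z * expi (- n) x + s) + gn n * expi n x
            = s + (gn n * expi n x + gn (- n)%Z * expi (- n) x))%C.
    ring.
Qed.

Lemma decay_nat gn D r d :
  (forall n : Z, Cmod (gn n) <= D * r ^ Z.abs_nat n) ->
  Cmod (gn (Z.of_nat d)) <= D * r ^ d /\
  Cmod (gn (- Z.of_nat d)%Z) <= D * r ^ d.
Proof.
  intros decay.
  split; eapply Rle_trans; try apply decay; right; do 2 f_equal; lia.
Qed.

Lemma mode_pair_bound gn D r u v d b :
  (forall n : Z, Cmod (gn n) <= D * r ^ Z.abs_nat n) ->
  Cmod (u (S d)) <= b -> Cmod (v (S d)) <= b ->
  Cmod (mode_pair gn u v (S d)) <= 2 * D * r ^ S d * b.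
Proof.
  intros decay Hu Hv. unfold mode_pair.
  destruct (decay_nat gn D r (S d) decay) as [Hp Hm].
  eapply Rle_trans; [apply Cmod_triangle|]. rewrite !Cmod_mult.
  replace (2 * D * r ^ S d * b) with (D * r ^ S d * b + D * r ^ S d * b) by ring.
  apply Rplus_le_compat; apply Rmult_le_compat; trivial; apply Cmod_ge_0.
Qed.

Lemma fourier_partial_cauchy gn D r x M n :
  0 < r < 1 ->
  (forall n : Z, Cmod (gn n) <= D * r ^ Z.abs_nat n) ->
  Cmod (fourier_partial gn x (M + n) - fourier_partial gn x M)%C
  <= 2 * D * (r ^ S M - r ^ S (M + n)) / (1 - r).
Proof.
  intros r_range decay.
  induction n as [|n IH].
  - rewrite Nat.add_0_r.
    replace (_ - _)%C with (RtoC 0) by ring.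
    rewrite Cmod_0. right. field. lra.
  - rewrite Nat.add_succ_r, !fourier_partial_eq, sum_Sn, <- !fourier_partial_eq.
    set (m := mode_pair _ _ _ _).
    change (plus (fourier_partial gn x (M + n)) m)
      with (fourier_partial gn x (M + n) + m)%C.
    replace (_ + m - _)%C with
      ((fourier_partial gn x (M + n) - fourier_partial gn x M) + m)%C by ring.
    eapply Rle_trans; [apply Cmod_triangle|].
    assert (Hm : Cmod m <= 2 * D * r ^ S (M + n) * 1)
      by (apply mode_pair_bound; trivial; rewrite Cmod_expi; lra).
    eapply Rle_trans; [apply Rplus_le_compat; [exact IH|exact Hm]|].
    right. simpl. field. lra.
Qed.

(** Partial sums beyond order [M] stay within a geometric tail of the [M]-th
    one, and they converge to [g x]. *)
Lemma fourier_tail g gn D r x M :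
  has_fourier_series g gn -> 0 < D -> 0 < r < 1 ->
  (forall n : Z, Cmod (gn n) <= D * r ^ Z.abs_nat n) ->
  Cmod (RtoC (g x) - fourier_partial gn x M)%C <= 2 * D * r ^ S M / (1 - r).
Proof.
  intros [_ Hg] D_pos r_range decay. specialize (Hg x).
  apply le_epsilon. intros eps Heps.
  assert (He2 : 0 < eps / 2) by lra.
  destruct (proj1 (filterlim_locally _ _) Hg (mkposreal _ He2)) as [n Hn].
  specialize (Hn (M + n)%nat ltac:(lia)). destruct Hn as [H1 H2].
  change (Rabs (fst (fourier_partial gn x (M + n)) - g x) < eps / 2) in H1.
  change (Rabs (snd (fourier_partial gn x (M + n)) - 0) < eps / 2) in H2.
  assert (Hc := fourier_partial_cauchy gn D r x M n r_range decay).
  set (P := fourier_partial gn x (M + n)) in *.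
  assert (Hd : Cmod (RtoC (g x) - P)%C <= eps).
  { assert (E : (RtoC (g x) - P)%C = (RtoC (g x - fst P) - Ci * RtoC (snd P))%C).
    { destruct P; apply injective_projections; simpl; ring. }
    rewrite E. eapply Rle_trans; [apply Cmod_triangle|].
    rewrite Cmod_opp, Cmod_mult, !Cmod_R, Cmod_Ci, Rmult_1_l.
    rewrite Rabs_minus_sym. rewrite Rminus_0_r in H2. lra. }
  replace (RtoC (g x) - fourier_partial gn x M)%C
    with ((RtoC (g x) - P) + (P - fourier_partial gn x M))%C by ring.
  eapply Rle_trans; [apply Cmod_triangle|].
  assert (2 * D * (r ^ S M - r ^ S (M + n)) / (1 - r) <= 2 * D * r ^ S M / (1 - r)).
  { apply Rmult_le_compat_r; [left; apply Rinv_0_lt_compat; lra|].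
    assert (0 < r ^ S (M + n)) by (apply pow_lt; lra).
    apply Rmult_le_compat_l; lra. }
  lra.
Qed.

(** The imaginary part of a partial sum has mean [Im g_0] over a period, because
    every other mode has a periodic primitive; by the mean value theorem it takes
    its mean value somewhere. *)
Lemma mean_mode_MVT gn M : exists xi, Im (fourier_partial gn xi M) = Im (gn 0%Z).
Proof.
  assert (Hprim : forall M, exists F : R -> R,
    (forall x, is_derive F x (Im (fourier_partial gn x M))) /\
    F (2 * PI) - F 0 = 2 * PI * Im (gn 0%Z)).
  { clear M. induction M as [|M [F [HF HP]]].
    - exists (fun x => Im (gn 0%Z) * x). split; [|ring].
      intros x. auto_derive; trivial. rewrite fourier_partial_eq, sum_O.
      unfold mode_pair. rewrite expi_eq, Rmult_0_l, cos_0, sin_0. simpl.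
      unfold Im. ring.
    - set (n := Z.of_nat (S M)).
      assert (Hn : IZR n <> 0) by (apply not_0_IZR; lia).
      exists (fun x => F x
        + ((Im (gn n) + Im (gn (- n)%Z)) * (sin (IZR n * x) / IZR n)
           - (Re (gn n) - Re (gn (- n)%Z)) * (cos (IZR n * x) / IZR n))).
      split.
      + intros x. rewrite fourier_partial_eq, sum_Sn, <- fourier_partial_eq.
        apply (is_derive_plus (K := R_AbsRing) (V := R_NormedModule)); [apply HF|].
        auto_derive; trivial. unfold mode_pair. fold n. rewrite !expi_eq, opp_IZR.
        simpl. rewrite Ropp_mult_distr_l_reverse, cos_neg, sin_neg.
        unfold Re, Im. field. trivial.
      + replace (IZR n * (2 * PI)) with (0 + 2 * INR (S M) * PI)
          by (unfold n; rewrite <- INR_IZR_INZ; ring).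
        rewrite cos_period, sin_period, Rmult_0_r. lra. }
  destruct (Hprim M) as [F [HF HP]].
  assert (HPI := PI_RGT_0).
  destruct (MVT_gen F 0 (2 * PI) (fun x => Im (fourier_partial gn x M)))
    as [xi [_ Hxi]].
  - intros; apply HF.
  - intros x _. apply derivable_continuous_pt.
    eexists. apply is_derive_Reals, HF.
  - exists xi. rewrite HP in Hxi. apply (Rmult_eq_reg_r (2 * PI)); lra.
Qed.

(** A partial sum approximates the real number [g x] uniformly in [x], so its
    imaginary part is uniformly small, and so is the mean of that part. *)
Lemma mean_mode_real g gn D r :
  has_fourier_series g gn -> 0 < D -> 0 < r < 1 ->
  (forall n : Z, Cmod (gn n) <= D * r ^ Z.abs_nat n) ->
  Im (gn 0%Z) = 0.
Proof.
  intros Hg D_pos r_range decay.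
  assert (HM : forall M, Rabs (Im (gn 0%Z)) <= 2 * D / (1 - r) * r ^ S M).
  { intros M. destruct (mean_mode_MVT gn M) as [xi <-].
    assert (Ht := fourier_tail g gn D r xi M Hg D_pos r_range decay).
    assert (Hi := Rmax_Cmod (RtoC (g xi) - fourier_partial gn xi M)%C).
    assert (Hs := Rmax_r (Rabs (fst (RtoC (g xi) - fourier_partial gn xi M)%C))
                         (Rabs (snd (RtoC (g xi) - fourier_partial gn xi M)%C))).
    replace (snd (RtoC (g xi) - fourier_partial gn xi M)%C)
      with (- Im (fourier_partial gn xi M)) in * by (unfold Im; simpl; ring).
    rewrite Rabs_Ropp in *.
    replace (2 * D / (1 - r) * r ^ S M) with (2 * D * r ^ S M / (1 - r))
      by (field; lra).
    lra. }
  destruct (Req_dec (Im (gn 0%Z)) 0) as [|Hne]; trivial. exfalso.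
  apply Rabs_pos_lt in Hne.
  assert (HK : 0 < 2 * D / (1 - r)) by (apply Rdiv_lt_0_compat; lra).
  destruct (pow_lt_1_zero r ltac:(rewrite Rabs_pos_eq; lra)
    (Rabs (Im (gn 0%Z)) / (2 * D / (1 - r)))) as [n Hn].
  { apply Rdiv_lt_0_compat; trivial. }
  specialize (Hn (S n) ltac:(lia)). specialize (HM n).
  rewrite Rabs_pos_eq in Hn by (apply pow_le; lra).
  apply (Rmult_lt_compat_l _ _ _ HK) in Hn.
  replace (2 * D / (1 - r) * (Rabs (Im (gn 0%Z)) / (2 * D / (1 - r))))
    with (Rabs (Im (gn 0%Z))) in Hn by (field; lra).
  lra.
Qed.

(** * Differential inequalities on the half-line *)

Lemma minus_plus_cancel {G : AbelianGroup} (a b : G) :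
  minus (minus (plus a b) a) b = zero.
Proof.
  unfold minus. rewrite (plus_comm a b), <- (plus_assoc b a).
  rewrite (@plus_opp_r G a), plus_zero_r. apply (@plus_opp_r G b).
Qed.

(** Extending by the tangent at [0] to negative times replaces the one-sided
    derivative at [0] by an ordinary one, so that the usual calculus applies on
    the whole closed half-line. *)
Lemma is_derive_fwd_extension {V : NormedModule R_AbsRing} (f l : R -> V) :
  (forall s, 0 <= s -> is_derive_fwd f s (l s)) ->
  exists F : R -> V,
    (forall s, 0 <= s -> F s = f s) /\
    (forall s, 0 <= s -> is_derive F s (l s)).
Proof.
  intros Hf.
  exists (fun s => if Rle_dec 0 s then f s else plus (f 0) (scal s (l 0))).
  assert (HF : forall s, 0 <= s ->
    (if Rle_dec 0 s then f s else plus (f 0) (scal s (l 0))) = f s).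
  { intros s Hs. now destruct (Rle_dec 0 s). }
  split; [exact HF|].
  intros s Hs. destruct (Hf s Hs) as [Hlin Hdom]. split; [exact Hlin|].
  intros x Hx. apply (is_filter_lim_locally_unique s x) in Hx. subst x.
  specialize (Hdom s (fun P HP => filter_imp P _ (fun y Hy _ => Hy) HP)).
  intros eps. specialize (Hdom eps). unfold within in Hdom.
  rewrite HF by trivial.
  destruct (Rle_lt_or_eq_dec 0 s Hs) as [Hpos|<-].
  - generalize (filter_and _ _ Hdom (open_gt 0 s Hpos)).
    apply filter_imp. intros y [Hy Hy0]. rewrite HF by lra. apply Hy; lra.
  - revert Hdom. apply filter_imp. intros y Hy.
    destruct (Rle_dec 0 y) as [Hy0|Hy0]; [now apply Hy|].
    match goal with |- norm ?z <= _ => replace z with (@zero V) end.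
    + rewrite norm_zero. apply Rmult_le_pos; [left; apply eps|apply norm_ge_0].
    + change (zero = minus (minus (plus (f 0) (scal y (l 0))) (f 0))
                       (scal (y - 0)%R (l 0))).
      rewrite Rminus_0_r. symmetry.
      exact (@minus_plus_cancel (NormedModule.AbelianGroup R_AbsRing V) (f 0) _).
Qed.

Lemma is_derive_Re (f : R -> C) s l :
  is_derive (V := C_R_NormedModule) f s l -> is_derive (fun u => Re (f u)) s (Re l).
Proof.
  intros H.
  exact (filterdiff_comp' f (fun z : C_R_NormedModule => fst z) s _ _ H
    (filterdiff_linear _ is_linear_fst)).
Qed.

Lemma is_derive_Im (f : R -> C) s l :
  is_derive (V := C_R_NormedModule) f s l -> is_derive (fun u => Im (f u)) s (Im l).
Proof.
  intros H.
  exact (filterdiff_comp' f (fun z : C_R_NormedModule => snd z) s _ _ H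
    (filterdiff_linear _ is_linear_snd)).
Qed.

Lemma le_of_derive_le (f df phi dphi : R -> R) t : 0 <= t ->
  (forall s, 0 <= s -> is_derive f s (df s)) ->
  (forall s, 0 <= s -> is_derive phi s (dphi s)) ->
  (forall s, 0 <= s -> df s <= dphi s) ->
  f t - f 0 <= phi t - phi 0.
Proof.
  intros Ht Hf Hphi Hle.
  assert (Hd : forall s, 0 <= s ->
    is_derive (fun u => phi u - f u) s (dphi s - df s)).
  { intros s Hs. apply (is_derive_minus (K := R_AbsRing) (V := R_NormedModule)); auto. }
  destruct (MVT_gen (fun u => phi u - f u) 0 t (fun s => dphi s - df s))
    as [xi [Hxi E]]; try rewrite Rmin_left in * by trivial.
  - intros; apply Hd; lra.
  - intros s Hs. apply derivable_continuous_pt.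
    exists (dphi s - df s). apply is_derive_Reals, Hd; lra.
  - specialize (Hle xi ltac:(lra)). nra.
Qed.

(** Variation of constants for [f' = i w f + h], [f = u + i v], [f 0 = 0]: in the
    frame rotating with speed [w] only the forcing [h] moves [f], so [|f|] grows
    at most at rate [|h|]. To stay with real functions, [psi s] is the scalar
    product of [f t] with [e^{iw(t-s)} f s]; it goes from [0] to [|f t|^2] at rate
    at most [|f t| |h s|]. *)
Lemma rotating_frame_bound (u v : R -> R) (h : R -> C) (w : R) (phi dphi : R -> R) t :
  0 <= t -> u 0 = 0 -> v 0 = 0 ->
  (forall s, 0 <= s -> is_derive u s (- w * v s + Re (h s))) ->
  (forall s, 0 <= s -> is_derive v s (w * u s + Im (h s))) ->
  (forall s, 0 <= s -> is_derive phi s (dphi s)) ->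
  (forall s, 0 <= s -> Cmod (h s) <= dphi s) ->
  Cmod (u t, v t) <= phi t - phi 0.
Proof.
  intros Ht Hu0 Hv0 Hu Hv Hphi Hh.
  set (a := u t); set (b := v t); set (m := Cmod (a, b)).
  assert (Hm : 0 <= m) by apply Cmod_ge_0.
  assert (Hm2 : m * m = a * a + b * b).
  { unfold m, Cmod; simpl. rewrite sqrt_sqrt; nra. }
  pose (psi := fun s => cos (w * (t - s)) * (a * u s + b * v s)
                      - sin (w * (t - s)) * (a * v s - b * u s)).
  pose (dpsi := fun s => cos (w * (t - s)) * (a * Re (h s) + b * Im (h s))
                      - sin (w * (t - s)) * (a * Im (h s) - b * Re (h s))).
  assert (H : psi t - psi 0 <= m * phi t - m * phi 0).
  { apply (le_of_derive_le psi dpsi (fun s => m * phi s) (fun s => m * dphi s)); trivial.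
    - intros s Hs. specialize (Hu s Hs); specialize (Hv s Hs).
      unfold psi, dpsi.
      auto_derive.
      + repeat split; trivial; eexists; eassumption.
      + apply is_derive_unique in Hu, Hv.
        change (Derive (fun x => u x) s) with (Derive u s).
        change (Derive (fun x => v x) s) with (Derive v s).
        rewrite Hu, Hv. unfold Rminus.
        match goal with |- ?l = ?r => change (@eq R l r) end. ring.
    - intros s Hs. now apply is_derive_scal, Hphi.
    - intros s Hs. eapply Rle_trans; [|apply Rmult_le_compat_l, Hh; trivial].
      unfold dpsi. generalize (sin2_cos2 (w * (t - s))).
      unfold Rsqr. set (c := cos _); set (d := sin _). intros Hcd.
      assert (Hn : 0 <= Cmod (h s)) by apply Cmod_ge_0.
      assert (Hn2 : Cmod (h s) * Cmod (h s) = Re (h s) * Re (h s) + Im (h s) * Im (h s)).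
      { unfold Cmod, Re, Im; simpl. rewrite sqrt_sqrt; nra. }
      set (p := Re (h s)) in *; set (q := Im (h s)) in *.
      (* Cauchy-Schwarz; the discarded square belongs to the component of
         the rotated forcing orthogonal to [f t]. *)
      apply Rsqr_incr_0_var; [|now apply Rmult_le_pos]. unfold Rsqr.
      replace (m * Cmod (h s) * (m * Cmod (h s)))
        with ((m * m) * (Cmod (h s) * Cmod (h s))) by ring.
      rewrite Hm2, Hn2.
      replace ((a * a + b * b) * (p * p + q * q)) with
        ((d * d + c * c) *
          ((a * p + b * q) * (a * p + b * q) + (a * q - b * p) * (a * q - b * p)))
        by (rewrite Hcd; ring).
      generalize (Rle_0_sqr (d * (a * p + b * q) + c * (a * q - b * p))).
      unfold Rsqr. nra. }
  unfold psi in H. rewrite Rminus_diag, Rmult_0_r, cos_0, sin_0, Hu0, Hv0 in H.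
  fold a b in H.
  destruct (Rle_lt_or_eq_dec 0 m Hm) as [Hpos|H0]; [|rewrite <- H0 in *].
  - apply (Rmult_le_reg_l m); nra.
  (* If [f t = 0] the scalar product carries no information, and [phi] is only
     known to increase. *)
  - assert (Hmono : 0 - 0 <= phi t - phi 0).
    { apply (le_of_derive_le (fun _ => 0) (fun _ => 0) phi dphi); trivial.
      - intros; apply (is_derive_const (K := R_AbsRing) (V := R_NormedModule)).
      - intros s Hs. eapply Rle_trans; [apply Cmod_ge_0|now apply Hh]. }
    lra.
Qed.

(** * The error of the finite section *)

(** [sum_n] states equalities in the carrier of a monoid structure, which [ring]
    does not recognize as the complex numbers. *)
Ltac ring_C :=
  match goal with |- ?a = ?b => change (@eq C a b) end; ring.

Lemma sum_n_single a (z : C) n : (a <= n)%nat ->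
  sum_n (fun q => if Nat.eqb q a then z else RtoC 0) n = z.
Proof.
  assert (Hlt : forall j, (j < a)%nat ->
    sum_n (fun q => if Nat.eqb q a then z else RtoC 0) j = RtoC 0).
  { induction j as [|j IH]; intros Hj; [rewrite sum_O|rewrite sum_Sn, IH by lia];
    rewrite (proj2 (Nat.eqb_neq _ _)) by lia; trivial. apply Cplus_0_r. }
  induction n as [|n IH]; intros Ha.
  - rewrite sum_O. now replace a with O by lia.
  - rewrite sum_Sn. destruct (Nat.eq_dec a (S n)) as [->|Hne].
    + rewrite Hlt, Nat.eqb_refl by lia. apply Cplus_0_l.
    + rewrite IH, (proj2 (Nat.eqb_neq _ _)) by lia. apply Cplus_0_r.
Qed.

(** Row [p] of [B_{k,k+d}] meets only the columns [p] and [d+p], which carry the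
    modes [m+d] and [m-d] for [m = k-2p]: the action of a row is the convolution
    with the Fourier coefficients. *)
Lemma section_row_eq gn k p j (z : nat -> nat -> C) : (p <= k)%nat ->
  sum_n_m (fun l => sum_n (fun q => (Bcoef gn k l p q * z l q)%C) l) k (k + j) =
  (Ci * RtoC (IZR (Z.of_nat k - 2 * Z.of_nat p)) *
   sum_n (mode_pair gn (fun d => z (k + d)%nat p)
                       (fun d => z (k + d)%nat (d + p)%nat)) j)%C.
Proof.
  intros Hp. set (c := (Ci * _)%C).
  assert (Hblock : forall d,
    sum_n (fun q => (Bcoef gn k (k + d) p q * z (k + d)%nat q)%C) (k + d) =
    (c * mode_pair gn (fun d => z (k + d)%nat p)
                     (fun d => z (k + d)%nat (d + p)%nat) d)%C).
  { intros d. unfold Bcoef. fold c. replace (k + d - k + p)%nat with (d + p)%nat by lia.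
    destruct d as [|d].
    - rewrite <- (sum_n_single p (c * mode_pair gn _ _ 0)%C (k + 0)) by lia.
      apply sum_n_ext. intros q. unfold mode_pair.
      rewrite Nat.add_0_l, Nat.add_0_r, Z.sub_diag.
      destruct (Nat.eqb_spec q p) as [->|]; ring_C.
    - unfold mode_pair.
      rewrite Cmult_plus_distr_l.
      rewrite <- (sum_n_single p (c * (gn (Z.of_nat (S d)) * _))%C (k + S d)) by lia.
      rewrite <- (sum_n_single (S d + p) (c * (gn (- Z.of_nat (S d))%Z * _))%C (k + S d))
        by lia.
      change Cplus with (@plus C_AbelianMonoid). rewrite <- sum_n_plus.
      apply sum_n_ext. intros q. change (@plus C_AbelianMonoid) with Cplus.
      replace (Z.of_nat (k + S d) - Z.of_nat k)%Z with (Z.of_nat (S d)) by lia.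
      replace (Z.of_nat k - Z.of_nat (k + S d))%Z with (- Z.of_nat (S d))%Z by lia.
      destruct (Nat.eqb_spec q p) as [->|Hqp].
      + rewrite (proj2 (Nat.eqb_neq _ _)) by lia. ring_C.
      + destruct (Nat.eqb_spec q (S d + p)) as [->|]; ring_C. }
  induction j as [|j IH].
  - now rewrite sum_O, Nat.add_0_r, sum_n_n, <- Hblock, Nat.add_0_r.
  - rewrite Nat.add_succ_r, sum_n_Sm, IH by lia.
    rewrite (sum_Sn (mode_pair _ _ _)). change (@plus C_AbelianMonoid) with Cplus.
    now rewrite Cmult_plus_distr_l, <- Hblock, Nat.add_succ_r.
Qed.

Lemma mode_pair_ext gn u v u' v' d :
  u d = u' d -> v d = v' d -> mode_pair gn u v d = mode_pair gn u' v' d.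
Proof. intros Hu Hv. destruct d; unfold mode_pair; now rewrite Hu, ?Hv. Qed.

Lemma mode_sum_sub gn u v u' v' n :
  sum_n (mode_pair gn (fun d => u d - u' d)%C (fun d => v d - v' d)%C) n =
  (sum_n (mode_pair gn u v) n - sum_n (mode_pair gn u' v') n)%C.
Proof.
  induction n as [|n IH]; [rewrite !sum_O; simpl; ring|].
  rewrite !sum_Sn, IH. change (@plus C_AbelianMonoid) with Cplus.
  unfold mode_pair. ring_C.
Qed.

Lemma mode_sum_expi gn m n x :
  (fourier_partial gn x n * expi m x)%C =
  sum_n (mode_pair gn (fun d => expi (m + Z.of_nat d) x)
                      (fun d => expi (m - Z.of_nat d) x)) n.
Proof.
  rewrite fourier_partial_eq.
  induction n as [|n IH].
  - rewrite !sum_O. unfold mode_pair. rewrite expi_add. ring_C.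
  - rewrite !sum_Sn, <- IH. change (@plus C_AbelianMonoid) with Cplus.
    unfold mode_pair. unfold Z.sub. rewrite !expi_add. ring_C.
Qed.

Definition block_error (x : R -> R) (y : nat -> nat -> R -> C) (t : R) (k p : nat) : C :=
  (y k p t - expi (Z.of_nat k - 2 * Z.of_nat p) (x t))%C.

Lemma row_mode_bound k p : (p <= k)%nat ->
  Rabs (IZR (Z.of_nat k - 2 * Z.of_nat p)) <= INR k.
Proof.
  intros Hp. rewrite <- abs_IZR, INR_IZR_INZ. apply IZR_le. lia.
Qed.

(** The bounds on the higher blocks telescope: the weight [r^{-(k+d)}] of block
    [k+d] is compensated by the decay [r^d] of the coefficient coupling it to
    block [k], leaving the increments of the [majorant]s, which add up from
    block [k+j], where the [majorant] is [1], to block [k+1]. *)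
Lemma coupling_bound gn D r c k j s (u v : nat -> C) :
  0 < D -> 0 < r < 1 -> (forall n : Z, Cmod (gn n) <= D * r ^ Z.abs_nat n) ->
  (forall i, (i < j)%nat ->
     let b := c / r ^ (k + S i) *
       (majorant (k + S i) (S (j - S i)) s - majorant (S (k + S i)) (j - S i) s) in
     Cmod (u (S i)) <= b /\ Cmod (v (S i)) <= b) ->
  Cmod (sum_n (mode_pair gn u v) j - gn 0%Z * u O)%C
  <= 2 * D * (c / r ^ k) * (majorant (S k) j s - 1).
Proof.
  intros HD Hr Hgn Huv.
  assert (H : forall i, (i <= j)%nat ->
    Cmod (sum_n (mode_pair gn u v) i - gn 0%Z * u O)%C
    <= 2 * D * (c / r ^ k) * (majorant (S k) j s - majorant (S k + i) (j - i) s)).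
  { induction i as [|i IH]; intros Hi.
    - rewrite sum_O, Nat.add_0_r, Nat.sub_0_r. unfold mode_pair.
      replace (_ - _)%C with (RtoC 0) by ring. rewrite Cmod_0. right; ring.
    - specialize (IH ltac:(lia)). destruct (Huv i ltac:(lia)) as [Hu Hv].
      assert (Hb := mode_pair_bound gn D r u v i _ Hgn Hu Hv).
      rewrite sum_Sn. change (@plus C_AbelianMonoid) with Cplus.
      replace (sum_n _ i + _ - _)%C with
        ((sum_n (mode_pair gn u v) i - gn 0%Z * u O) + mode_pair gn u v (S i))%C by ring.
      eapply Rle_trans; [apply Cmod_triangle|].
      eapply Rle_trans; [apply Rplus_le_compat; [exact IH|exact Hb]|].
      replace (S (j - S i)) with (j - i)%nat by lia.
      replace (k + S i)%nat with (S k + i)%nat by lia.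
      replace (S (S k + i)) with (S k + S i)%nat by lia.
      right. replace (S k + i)%nat with (k + S i)%nat at 2 by lia.
      rewrite pow_add. field.
      split; apply pow_nonzero; lra. }
  specialize (H j ltac:(lia)). rewrite Nat.sub_diag in H.
  unfold majorant at 2 in H. simpl in H. now rewrite Rmult_1_r in H.
Qed.

(** Strong induction on the distance [j = N-k] to the last block. The tail of the
    series supplies exactly the constant [1] that the coupling leaves out, so the
    forcing of block [k] is dominated by [k] times the next [majorant]. *)
Lemma block_error_bound g gn D r x0 x N y :
  has_fourier_series g gn -> 0 < D -> 0 < r < 1 ->
  (forall n : Z, Cmod (gn n) <= D * r ^ Z.abs_nat n) ->
  solves_ode g x0 x -> solves_finite_section gn x0 N y ->
  forall j k p t, (1 <= k)%nat -> (k + j = N)%nat -> (p <= k)%nat -> 0 <= t ->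
  Cmod (block_error x y t k p) <=
  r ^ S N / (1 - r) / r ^ k *
    (majorant k (S j) (2 * D * t) - majorant (S k) j (2 * D * t)).
Proof.
  intros Hg HD Hr Hgn [Hx0 Hx] Hy j.
  set (c := r ^ S N / (1 - r)).
  destruct (is_derive_fwd_extension x _ Hx) as [X [HX HdX]].
  induction j as [j IH] using (well_founded_induction lt_wf).
  intros k p t Hk HkN Hp Ht.
  destruct (Hy k p ltac:(lia) Hp) as [Hy0 Hdy].
  destruct (is_derive_fwd_extension (y k p) _ Hdy) as [Y [HY HdY]].
  set (m := (Z.of_nat k - 2 * Z.of_nat p)%Z) in *.
  pose (E := fun s => sum_n (mode_pair gn
     (fun d => block_error x y s (k + d) p)
     (fun d => block_error x y s (k + d) (d + p))) j).
  pose (tail := fun s => (RtoC (g (x s)) - fourier_partial gn (x s) j)%C).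
  pose (h := fun s => (Ci * RtoC (IZR m) *
     ((E s - gn 0%Z * block_error x y s (k + 0) p) - tail s * expi m (x s)))%C).
  pose (L := fun s => sum_n_m (fun l => sum_n
     (fun q => (Bcoef gn k l p q * y l q s)%C) l) k N).
  assert (Hreal : gn 0%Z = RtoC (Re (gn 0%Z))).
  { apply injective_projections; [reflexivity|].
    exact (mean_mode_real g gn D r Hg HD Hr Hgn). }
  (* The equation for the error of entry [(k, p)], with the diagonal rotation
     singled out. *)
  assert (Hforce : forall s, 0 <= s ->
    (L s - Ci * RtoC (IZR m) * RtoC (g (x s)) * expi m (x s) =
     Ci * RtoC (IZR m * Re (gn 0%Z)) * (Y s - expi m (X s)) + h s)%C).
  { intros s Hs. unfold L.
    rewrite <- HkN, (section_row_eq gn k p j (fun l q => y l q s) Hp).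
    fold m. rewrite HX, HY by trivial. unfold h, E.
    unfold block_error. rewrite mode_sum_sub, Nat.add_0_r. fold m.
    replace (sum_n (mode_pair gn (fun d => expi (Z.of_nat (k + d) - 2 * Z.of_nat p) (x s))
       (fun d => expi (Z.of_nat (k + d) - 2 * Z.of_nat (d + p)) (x s))) j)
      with (fourier_partial gn (x s) j * expi m (x s))%C.
    - unfold tail. rewrite RtoC_mult, <- Hreal. ring.
    - rewrite mode_sum_expi. apply sum_n_ext. intros d. unfold m.
      apply mode_pair_ext; f_equal; lia. }
  assert (Hderiv : forall s, 0 <= s ->
    is_derive (fun u => Re (Y u - expi m (X u))%C) s
      (- (IZR m * Re (gn 0%Z)) * Im (Y s - expi m (X s))%C + Re (h s)) /\
    is_derive (fun u => Im (Y u - expi m (X u))%C) s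
      (IZR m * Re (gn 0%Z) * Re (Y s - expi m (X s))%C + Im (h s))).
  { intros s Hs. specialize (Hforce s Hs). specialize (HdX s Hs).
    specialize (HdY s Hs). change (is_derive (V := C_R_NormedModule) Y s (L s)) in HdY.
    assert (HRe := is_derive_Re _ _ _ HdY). assert (HIm := is_derive_Im _ _ _ HdY).
    rewrite <- (HX s Hs) in HdX, Hforce.
    assert (HfRe := f_equal Re Hforce). assert (HfIm := f_equal Im Hforce).
    rewrite expi_eq in HfRe, HfIm |- *.
    unfold Re, Im in *; simpl in HfRe, HfIm.
    split.
    - apply (is_derive_ext (fun u => fst (Y u) - cos (IZR m * X u)));
        [intros u; now rewrite expi_eq|].
      evar_last;
        [apply (is_derive_minus (K := R_AbsRing) (V := R_NormedModule)); [exact HRe|]|].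
      + auto_derive; [eexists; exact HdX|reflexivity].
      + change (Derive (fun x => X x) s) with (Derive X s).
        rewrite (is_derive_unique _ _ _ HdX).
        unfold minus, plus, opp; simpl. lra.
    - apply (is_derive_ext (fun u => snd (Y u) - sin (IZR m * X u)));
        [intros u; now rewrite expi_eq|].
      evar_last;
        [apply (is_derive_minus (K := R_AbsRing) (V := R_NormedModule)); [exact HIm|]|].
      + auto_derive; [eexists; exact HdX|reflexivity].
      + change (Derive (fun x => X x) s) with (Derive X s).
        rewrite (is_derive_unique _ _ _ HdX).
        unfold minus, plus, opp; simpl. lra. }
  (* The series tail in the units of the bound for block [k]. *)
  assert (Hck : 2 * D * r ^ S j / (1 - r) = 2 * D * (c / r ^ k)).
  { unfold c. replace (S N) with (k + S j)%nat by lia. rewrite pow_add.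
    field. split; try apply pow_nonzero; lra. }
  assert (Hbound : forall s, 0 <= s ->
    Cmod (h s) <= c / r ^ k * (INR k * majorant (S k) j (2 * D * s)) * (2 * D)).
  { intros s Hs. unfold h.
    assert (HE := coupling_bound gn D r c k j (2 * D * s)
      (fun d => block_error x y s (k + d) p)
      (fun d => block_error x y s (k + d) (d + p)) HD Hr Hgn).
    fold (E s) in HE. cbv beta zeta in HE.
    assert (HEs : Cmod (E s - gn 0%Z * block_error x y s (k + 0) p)%C <=
      2 * D * (c / r ^ k) * (majorant (S k) j (2 * D * s) - 1)).
    { apply HE. intros i Hi. split; apply IH; lia || trivial. }
    assert (HT := fourier_tail g gn D r (x s) j Hg HD Hr Hgn). fold (tail s) in HT.
    rewrite Hck in HT.
    rewrite !Cmod_mult, Cmod_Ci, Cmod_R, Rmult_1_l.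
    assert (Hm := row_mode_bound k p Hp). fold m in Hm.
    replace (c / r ^ k * (INR k * majorant (S k) j (2 * D * s)) * (2 * D)) with
      (INR k * (2 * D * (c / r ^ k) * (majorant (S k) j (2 * D * s) - 1)
        + 2 * D * (c / r ^ k)))
      by ring.
    apply Rmult_le_compat; trivial; [apply Rabs_pos|apply Cmod_ge_0|].
    eapply Rle_trans; [apply Cmod_triangle|].
    rewrite Cmod_opp, Cmod_mult, Cmod_expi. lra. }
  assert (Hphi : forall s, is_derive
    (fun s => c / r ^ k * (majorant k (S j) (2 * D * s) - majorant (S k) j (2 * D * s))) s
    (c / r ^ k * (INR k * majorant (S k) j (2 * D * s)) * (2 * D))).
  { intros s. pose (w := fun s => majorant k (S j) s - majorant (S k) j s).
    assert (HW : is_derive w (2 * D * s) (INR k * majorant (S k) j (2 * D * s)))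
      by apply is_derive_majorant_increment.
    apply (is_derive_ext (fun s => c / r ^ k * w (2 * D * s))); [reflexivity|].
    auto_derive; [eexists; exact HW|].
    change (Derive (fun x => w x)) with (Derive w).
    rewrite (is_derive_unique _ _ _ HW).
    match goal with |- ?a = ?b => change (@eq R a b) end. ring. }
  unfold block_error. fold m. rewrite <- HX, <- HY by trivial.
  rewrite (surjective_pairing (Y t - expi m (X t))%C).
  assert (Hinit : (Y 0 - expi m (X 0))%C = RtoC 0).
  { rewrite HX, HY, Hx0, Hy0 by lra. unfold y_init. fold m. ring. }
  eapply Rle_trans;
    [refine (rotating_frame_bound
      (fun u => Re (Y u - expi m (X u))%C) (fun u => Im (Y u - expi m (X u))%C)
      h (IZR m * Re (gn 0%Z)) _ _ t Ht _ _ _ _ (fun s _ => Hphi s) Hbound)|].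
  - now rewrite Hinit.
  - now rewrite Hinit.
  - apply Hderiv.
  - apply Hderiv.
  - cbv beta. rewrite Rmult_0_r, majorant_increment_0. lra.
Qed.

Theorem theorem3p1 :
  forall (g : R -> R) (gn : Z -> C) (D r x0 : R) (x : R -> R),
    has_fourier_series g gn ->
    0 < D ->
    0 < r < 1 ->
    (forall n : Z, Cmod (gn n) <= D * r ^ Z.abs_nat n) ->
    solves_ode g x0 x ->
    forall (N : nat) (y : nat -> nat -> R -> C),
      (1 <= N)%nat ->
      solves_finite_section gn x0 N y ->
      forall t : R, 0 <= t <= T0 D r ->
        Cmod (y 1%nat 0%nat t - expi 1 (x t))%C <= error_bound D r N t /\
        Cmod (y 1%nat 1%nat t - expi (-1) (x t))%C <= error_bound D r N t.
Proof.
  intros g gn D r x0 x Hg HD Hr Hgn Hx N y HN Hy t [Ht _].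
  destruct N as [|n]; [lia|].
  assert (Hblock : forall p, (p <= 1)%nat ->
    Cmod (block_error x y t 1 p) <= error_bound D r (S n) t).
  { intros p Hp.
    eapply Rle_trans;
      [apply (block_error_bound g gn D r x0 x (S n) y Hg HD Hr Hgn Hx Hy n);
       lia || trivial|].
    assert (Hs : 0 <= 2 * D * t) by (apply Rmult_le_pos; lra).
    assert (HW := majorant_first_bound n (2 * D * t) Hs).
    assert (HN0 : INR (S n) <> 0) by (apply not_0_INR; lia).
    replace (error_bound D r (S n) t) with
      (r ^ S (S n) / (1 - r) / r ^ 1 *
        (sqrt (2 * D * t) / INR (S n) * (1 + sqrt (2 * D * t)) ^ (2 * S n))).
    - apply Rmult_le_compat_l; [|exact HW].
      apply Rdiv_le_0_compat; [|apply pow_lt; lra].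
      apply Rdiv_le_0_compat; [apply pow_le|]; lra.
    - unfold error_bound. rewrite pow_1, <- (tech_pow_Rmult r (S n)).
      field. repeat split; lra. }
  split; [exact (Hblock 0%nat ltac:(lia))|exact (Hblock 1%nat ltac:(lia))].
Qed.
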